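(* Let $p,q\in[0,1]$ with $p\le q$, and let $\gamma_{p,q}$ be the forecasting system defined, for all $(z_1,\dots,z_n)\in\Omega^\lozenge$, by $\gamma_{p,q}(z_1,\dots,z_n)=p$ if $n$ is odd and $\gamma_{p,q}(z_1,\dots,z_n)=q$ if $n$ is even. Consider any $\omega\in\Omega$ that is computably random for $\gamma_{p,q}$. Then for all $I\in\mathcal{C}$: $I\in\mathcal{C}_{\mathrm{C}}(\omega)$ if and only if $[p,q]\subseteq I$.
   Context: $\mathbb{N}=\{1,2,\dots\}$, $\mathbb{N}_0=\mathbb{N}\cup\{0\}$. $\mathcal{C}$ is the set of all non-empty closed subintervals of $[0,1]$ (interval forecasts). For $I\in\mathcal{C}$ and $f\colon\{0,1\}\to\mathbb{R}$, $\overline{E}_I(f)=\max_{p\in I}[pf(1)+(1-p)f(0)]$. $\Omega=\{0,1\}^{\mathbb{N}}$ is the set of outcome sequences and $\Omega^\lozenge=\bigcup_{n\in\mathbb{N}_0}\{0,1\}^n$ the set of situations, with $\square$ the empty sequence ($n=0$). For $\omega\in\Omega$, $\omega^n$ is its initial segment of length $n$. A forecasting system is a map $\gamma\colon\Omega^\lozenge\to\mathcal{C}$; a precise forecast, i.e. a number $p\in[0,1]$, is identified with the interval $\{p\}\in\mathcal{C}$. A real process is a map $F\colon\Omega^\lozenge\to\mathbb{R}$, with process difference $\Delta F(s)(x)=F(sx)-F(s)$. A supermartingale for $\gamma$ is a real process $M$ with $\overline{E}_{\gamma(s)}(\Delta M(s))\le 0$ for all $s\in\Omega^\lozenge$; a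 test supermartingale for $\gamma$ is a non-negative supermartingale $T$ for $\gamma$ with $T(\square)=1$. A real process $F$ is computable if there are rational numbers $r_{s,n}=(-1)^{\sigma(s,n)}a(s,n)/b(s,n)$, with $a,b,\sigma\colon\Omega^\lozenge\times\mathbb{N}_0\to\mathbb{N}_0$ computable and $b>0$, and a computable function $e\colon\Omega^\lozenge\times\mathbb{N}_0\to\mathbb{N}_0$, such that $n\ge e(s,N)$ implies $|r_{s,n}-F(s)|\le 2^{-N}$ for all $s,n,N$. An outcome sequence $\omega$ is computably random for $\gamma$ if $\sup_{n\in\mathbb{N}}T(\omega^n)<+\infty$ for every computable test supermartingale $T$ for $\gamma$. For $I\in\mathcal{C}$, the stationary forecasting system $\gamma_I$ is given by $\gamma_I(s)=I$ for all $s\in\Omega^\lozenge$, and $\mathcal{C}_{\mathrm{C}}(\omega)=\{I\in\mathcal{C}\colon\omega\text{ is computably random for }\gamma_I\}$. *)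

(* Defs.v *)
From mathcomp Require Import all_boot all_order all_algebra.
From mathcomp Require Import all_classical all_reals all_analysis.

Set Implicit Arguments.
Unset Strict Implicit.
Unset Printing Implicit Defensive.

Import Order.TTheory GRing.Theory Num.Theory.

Local Open Scope classical_set_scope.
Local Open Scope ring_scope.

(* The total recursive functions on tuples of naturals: the least class *)
(* containing the initial functions and closed under composition, primitive *)
(* recursion and minimisation of regular functions. The last two closure rules *)
(* characterise the new function h by its defining equations. *)
Inductive recursive : forall n : nat, (n.-tuple nat -> nat) -> Prop :=
| recursive_zero n :
    recursive (fun _ : n.-tuple nat => 0%N)
| recursive_succ :
    recursive (fun v : 1.-tuple nat => (thead v).+1)
| recursive_proj n (i : 'I_n) :
    recursive (fun v : n.-tuple nat => tnth v i)
| recursive_comp m n (f : m.-tuple nat -> nat)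
      (g : 'I_m -> n.-tuple nat -> nat) :
    recursive f -> (forall i, recursive (g i)) ->
    recursive (fun v => f [tuple g i v | i < m])
| recursive_primrec n (f : n.-tuple nat -> nat) (g : n.+2.-tuple nat -> nat)
      (h : n.+1.-tuple nat -> nat) :
    recursive f -> recursive g ->
    (forall v : n.-tuple nat, h [tuple of 0%N :: v] = f v) ->
    (forall k (v : n.-tuple nat), h [tuple of k.+1 :: v] =
                 g [tuple of k :: h [tuple of k :: v] :: v]) ->
    recursive h
| recursive_mu n (f : n.+1.-tuple nat -> nat) (h : n.-tuple nat -> nat) :
    recursive f ->
    (forall v : n.-tuple nat, f [tuple of h v :: v] = 0%N) ->
    (forall (v : n.-tuple nat) k, (k < h v)%N -> f [tuple of k :: v] <> 0%N) ->
    recursive h.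

(* Outcomes 0 and 1 are false and true. *)
Definition situation := seq bool.

(* The first outcome is omega 0, so the initial segment of length n consists *)
(* of omega 0, ..., omega n.-1. *)
Definition outcome_sequence := nat -> bool.

Definition initial_segment (omega : outcome_sequence) (n : nat) : situation :=
  mkseq omega n.

(* Bijective base-2 numeration, i.e. the rank of s when situations are ordered *)
(* first by length and then lexicographically. *)
Definition situation_code (s : situation) : nat :=
  foldl (fun (m : nat) (x : bool) => (m.*2 + x).+1%N) 0%N s.

Definition computable_map (f : situation -> nat -> nat) : Prop :=
  exists2 g : 2.-tuple nat -> nat, recursive g &
    forall s n, f s n = g [tuple situation_code s; n].

Section Forecasting.
Context {R : realType}.

Record interval_forecast := IntervalForecast {
  forecast_set :> set R;
  forecast_setP : exists a b : R,
    [/\ 0 <= a, a <= b, b <= 1 & forecast_set = `[a, b]%classic] }.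

Lemma set1_forecast (p : R) (hp : 0 <= p <= 1) :
  exists a b : R, [/\ 0 <= a, a <= b, b <= 1 & [set p] = `[a, b]%classic].
Proof. by case/andP: hp => p0 p1; exists p, p; rewrite set_itv1. Qed.

Definition precise_forecast (p : R) (hp : 0 <= p <= 1) : interval_forecast :=
  IntervalForecast (set1_forecast hp).

(* The set is nonempty and compact, so its supremum is a maximum. *)
Definition upper_expectation (I : interval_forecast) (f : bool -> R) : R :=
  sup [set p * f true + (1 - p) * f false | p in I].

Definition forecasting_system := situation -> interval_forecast.

Definition real_process := situation -> R.

Definition process_difference (F : real_process) (s : situation) (x : bool) :
    R :=
  F (rcons s x) - F s.

Definition supermartingale (gamma : forecasting_system) (M : real_process) :
    Prop :=
  forall s, upper_expectation (gamma s) (process_difference M s) <= 0.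

Definition test_supermartingale (gamma : forecasting_system)
    (T : real_process) : Prop :=
  [/\ supermartingale gamma T, forall s, 0 <= T s & T [::] = 1].

Definition computable_process (F : real_process) : Prop :=
  exists a b sigma e : situation -> nat -> nat,
    [/\ [/\ computable_map a, computable_map b, computable_map sigma &
            computable_map e],
        forall s n, (0 < b s n)%N &
        forall s n N, (e s N <= n)%N ->
          `|(-1) ^+ sigma s n * (a s n)%:R / (b s n)%:R - F s| <= 2 ^- N].

Definition computably_random (gamma : forecasting_system)
    (omega : outcome_sequence) : Prop :=
  forall T, computable_process T -> test_supermartingale gamma T ->
    (ereal_sup [set (T (initial_segment omega n))%:E | n in [set n | (0 < n)%N]]
      < +oo)%E.

Definition stationary (I : interval_forecast) : forecasting_system := fun=> I.

Definition CC (omega : outcome_sequence) : set interval_forecast :=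
  [set I | computably_random (stationary I) omega].

Definition alternating_forecast (p q : R) (hp : 0 <= p <= 1) (hq : 0 <= q <= 1) :
    forecasting_system :=
  fun s => if odd (size s) then precise_forecast hp else precise_forecast hq.

End Forecasting.

Arguments interval_forecast R : clear implicits.
Arguments real_process R : clear implicits.
Arguments forecasting_system R : clear implicits.

(* Main.v *)
(* If [p, q] is contained in I, every test supermartingale for the stationary
   system is one for the alternating system. Conversely, suppose that I misses
   p or q. Then on the situations of one length parity the forecasts of the two
   systems are separated by rationals c1 < c2: those of one system are at most
   c1, those of the other at least c2. Betting on these situations only, the
   factor 1 + e (x - c1) gives a test supermartingale for the first system and
   1 - e (x - c2) one for the second. For small e the product of the two factors
   exceeds 1 by a positive constant for both outcomes x, so along any outcome
   sequence one of the two supermartingales is unbounded, and the sequence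
   cannot be computably random for both systems. *)
Require Import Defs.
From mathcomp Require Import all_boot all_order all_algebra.
From mathcomp Require Import all_classical all_reals all_analysis.
From mathcomp Require Import zify ring lra.

Set Implicit Arguments.
Unset Strict Implicit.
Unset Printing Implicit Defensive.

Import Order.TTheory GRing.Theory Num.Theory.

Local Open Scope classical_set_scope.
Local Open Scope ring_scope.

(** * Recursive functions *)

Lemma eq_recursive n (f g : n.-tuple nat -> nat) :
  f =1 g -> recursive f -> recursive g.
Proof. by move=> /funext ->. Qed.

Lemma recursive_reindex m n (h : 'I_m -> 'I_n) (f : m.-tuple nat -> nat) :
  recursive f ->
  recursive (fun v : n.-tuple nat => f [tuple tnth v (h i) | i < m]).
Proof. by move=> rf; apply: recursive_comp => // i; apply: recursive_proj. Qed.

Lemma recursive_behead n (f : n.-tuple nat -> nat) :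
  recursive f -> recursive (fun v : n.+1.-tuple nat => f [tuple of behead v]).
Proof.
move=> /(recursive_reindex (lift ord0)); apply: eq_recursive => v.
congr f; apply: eq_from_tnth => i.
rewrite tnth_mktuple tnth_behead; congr (tnth v _).
by apply: val_inj; rewrite /= inordK // ltnS.
Qed.

Lemma recursive_thead n : recursive (fun v : n.+1.-tuple nat => thead v).
Proof. exact: (recursive_proj ord0). Qed.

(** Recursion along a computed bound [c v]: the rule [recursive_primrec] is applied with the counter
    at the head of the tuple, and [c v] is then substituted for it. *)
Lemma recursive_natrec n (c b : n.-tuple nat -> nat)
    (g : nat -> nat -> n.-tuple nat -> nat) :
  recursive c -> recursive b ->
  recursive (fun w : n.+2.-tuple nat =>
    g (thead w) (thead [tuple of behead w]) [tuple of behead (behead w)]) ->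
  recursive (fun v => nat_rect (fun=> nat) (b v) (fun k y => g k y v) (c v)).
Proof.
move=> rc rb rg.
pose h (w : n.+1.-tuple nat) :=
  nat_rect (fun=> nat) (b [tuple of behead w])
    (fun k y => g k y [tuple of behead w]) (thead w).
have beheadK k (v : n.-tuple nat) : [tuple of behead [tuple of k :: v]] = v.
  exact: val_inj.
have rh : recursive h.
  apply: (recursive_primrec rb rg) => [v|k v].
    by rewrite /h beheadK theadE.
  rewrite /h !beheadK !theadE /=.
  by congr (g _ _ _); apply: val_inj.
have rcv (i : 'I_n.+1) : recursive (fun v => tnth [tuple of c v :: v] i).
  case: (unliftP ord0 i) => [j ->|->].
    by apply: eq_recursive (recursive_proj j) => v; rewrite tnthS.
  by apply: eq_recursive rc => v; rewrite tnth0.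
apply: eq_recursive (recursive_comp rh rcv) => v.
have -> : [tuple tnth [tuple of c v :: v] i | i < n.+1] = [tuple of c v :: v].
  by apply: eq_from_tnth => i; rewrite tnth_mktuple.
by rewrite /h beheadK theadE.
Qed.

Lemma recursiveS n (f : n.-tuple nat -> nat) :
  recursive f -> recursive (fun v => (f v).+1).
Proof.
move=> rf; apply: eq_recursive (recursive_comp recursive_succ (fun=> rf)) => v.
by rewrite /thead tnth_mktuple.
Qed.

Lemma recursive_const n k : recursive (fun _ : n.-tuple nat => k).
Proof. by elim: k => [|k]; [exact: recursive_zero|exact: recursiveS]. Qed.

Lemma recursive_thead2 n :
  recursive (fun v : n.+2.-tuple nat => thead [tuple of behead v]).
Proof. exact: recursive_behead (recursive_thead _). Qed.

Lemma recursive_behead2 n (f : n.-tuple nat -> nat) :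
  recursive f ->
  recursive (fun v : n.+2.-tuple nat => f [tuple of behead (behead v)]).
Proof.
move=> /recursive_behead/recursive_behead; apply: eq_recursive => v.
by congr f; apply: val_inj.
Qed.

Lemma recursiveD n (f g : n.-tuple nat -> nat) :
  recursive f -> recursive g -> recursive (fun v => f v + g v)%N.
Proof.
move=> rf rg.
have := recursive_natrec (g := fun _ y _ => y.+1) rf rg
  (recursiveS (recursive_thead2 _)).
by apply: eq_recursive => v; elim: (f v) => //= k ->.
Qed.

Lemma recursiveM n (f g : n.-tuple nat -> nat) :
  recursive f -> recursive g -> recursive (fun v => f v * g v)%N.
Proof.
move=> rf rg.
have := recursive_natrec (g := fun _ y v => g v + y)%N rf (recursive_zero n)
  (recursiveD (recursive_behead2 rg) (recursive_thead2 _)).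
by apply: eq_recursive => v; elim: (f v) => //= k ->.
Qed.

Lemma recursive_if n (c f g : n.-tuple nat -> nat) :
  recursive c -> recursive f -> recursive g ->
  recursive (fun v => if c v == 0%N then f v else g v).
Proof.
move=> rc rf rg.
have := recursive_natrec (g := fun _ _ v => g v) rc rf (recursive_behead2 rg).
by apply: eq_recursive => v; case: (c v).
Qed.

Lemma recursive_odd n (f : n.-tuple nat -> nat) :
  recursive f -> recursive (fun v => odd (f v) : nat).
Proof.
move=> rf.
have := recursive_natrec (g := fun _ y _ => if y == 0 then 1 else 0)%N rf
  (recursive_zero n) (recursive_if (recursive_thead2 _) (recursive_const _ 1)
    (recursive_zero _)).
by apply: eq_recursive => v; elim: (f v) => //= k ->; case: odd.
Qed.

Lemma recursive_pred n (f : n.-tuple nat -> nat) :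
  recursive f -> recursive (fun v => (f v).-1).
Proof.
move=> rf.
have := recursive_natrec (g := fun k _ _ => k) rf (recursive_zero n)
  (recursive_thead _).
by apply: eq_recursive => v; case: (f v).
Qed.

Lemma recursive_half n (f : n.-tuple nat -> nat) :
  recursive f -> recursive (fun v => (f v)./2).
Proof.
move=> rf.
have := recursive_natrec (g := fun k y _ => odd k + y)%N rf (recursive_zero n)
  (recursiveD (recursive_odd (recursive_thead _)) (recursive_thead2 _)).
by apply: eq_recursive => v; elim: (f v) => //= k ->; rewrite uphalf_half.
Qed.

Lemma recursive_big n (op : nat -> nat -> nat) idx (c : n.-tuple nat -> nat)
    (f : nat -> n.-tuple nat -> nat) :
  (forall m (g h : m.-tuple nat -> nat), recursive g -> recursive h ->
    recursive (fun v => op (g v) (h v))) ->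
  recursive c ->
  recursive (fun w : n.+1.-tuple nat => f (thead w) [tuple of behead w]) ->
  recursive (fun v => nat_rect (fun=> nat) idx (fun k y => op y (f k v)) (c v)).
Proof.
move=> rop rc rf; apply: recursive_natrec => //; first exact: recursive_const.
apply: rop; first exact: recursive_thead2.
(* The step function receives [k :: y :: v]; this reindexing skips the accumulator [y], which [f]
   does not take. *)
have := recursive_reindex (fun i : 'I_n.+1 =>
  if unlift ord0 i is Some j then lift ord0 (lift ord0 j) else ord0) rf.
apply: eq_recursive => w; congr (f _ _).
  by rewrite /thead tnth_mktuple unlift_none.
apply: eq_from_tnth => i.
have beheadE m (v : m.+1.-tuple nat) j :
    tnth [tuple of behead v] j = tnth v (lift ord0 j).
  by rewrite [in RHS](tuple_eta v) tnthS.
rewrite beheadE tnth_mktuple liftK -beheadE -beheadE.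
by congr (tnth _ _); apply: val_inj.
Qed.

Lemma recursive_sum n (c : n.-tuple nat -> nat) (f : nat -> n.-tuple nat -> nat) :
  recursive c ->
  recursive (fun w : n.+1.-tuple nat => f (thead w) [tuple of behead w]) ->
  recursive (fun v => \sum_(k < c v) f k v)%N.
Proof.
move=> rc rf; apply: eq_recursive (recursive_big 0%N recursiveD rc rf) => v.
by elim: (c v) => [|k IHk] /=; rewrite ?big_ord0 // big_ord_recr /= IHk.
Qed.

Lemma recursive_prod n (c : n.-tuple nat -> nat) (f : nat -> n.-tuple nat -> nat) :
  recursive c ->
  recursive (fun w : n.+1.-tuple nat => f (thead w) [tuple of behead w]) ->
  recursive (fun v => \prod_(k < c v) f k v)%N.
Proof.
move=> rc rf; apply: eq_recursive (recursive_big 1%N recursiveM rc rf) => v.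
by elim: (c v) => [|k IHk] /=; rewrite ?big_ord0 // big_ord_recr /= IHk.
Qed.

(** * Products along a situation, computed from its code *)

(* The code of s without its last outcome. *)
Definition parent_code (m : nat) : nat := m.-1./2.

Lemma situation_code_rcons s x :
  situation_code (rcons s x) = ((situation_code s).*2 + x).+1%N.
Proof. by rewrite /situation_code foldl_rcons. Qed.

Lemma parent_code_rcons s x :
  parent_code (situation_code (rcons s x)) = situation_code s.
Proof. by rewrite situation_code_rcons /parent_code /= addnC half_bit_double. Qed.

Lemma odd_situation_code_rcons s x :
  odd (situation_code (rcons s x)) = ~~ x.
Proof. by rewrite situation_code_rcons /= oddD odd_double oddb. Qed.

Lemma iter_parent_code0 k : iter k parent_code 0%N = 0%N.
Proof. by elim: k => //= k ->. Qed.

(** Each outcome raises the code by at least one. Hence sums and products over the ancestors of [s]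
    may run up to the code, which is available as an argument. *)
Lemma size_situation_code s : (size s <= situation_code s)%N.
Proof.
elim/last_ind: s => // s x IHs.
by rewrite size_rcons situation_code_rcons; lia.
Qed.

Lemma recursive_iter_parent n (c f : n.-tuple nat -> nat) :
  recursive c -> recursive f ->
  recursive (fun v => iter (c v) parent_code (f v)).
Proof.
move=> rc rf.
have := recursive_natrec (g := fun _ y _ => parent_code y) rc rf
  (recursive_half (recursive_pred (recursive_thead2 _))).
by apply: eq_recursive => v; elim: (c v) => //= k ->.
Qed.

(** Only the empty situation has code 0, and 0 is fixed by [parent_code], so counting the non-zero
    iterates recovers the length. *)
Definition code_size (m : nat) : nat :=
  (\sum_(k < m) if iter k parent_code m == 0 then 0 else 1)%N.

Lemma code_sizeE s : code_size (situation_code s) = size s.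
Proof.
(* The range is freed from the code, since induction passes to the parent, whose code is smaller. *)
suff H K : (size s <= K)%N ->
    (\sum_(k < K) (if iter k parent_code (situation_code s) == 0 then 0 else 1)
      = size s)%N.
  exact/H/size_situation_code.
elim/last_ind: s K => [|s x IHs] [|K].
- by rewrite big_ord0.
- by move=> _; rewrite big1 // => i _; rewrite iter_parent_code0.
- by rewrite size_rcons.
rewrite size_rcons ltnS => sK; rewrite big_ord_recl.
under eq_bigr do rewrite iterSr parent_code_rcons.
by rewrite IHs // situation_code_rcons.
Qed.

Lemma recursive_code_size n (f : n.-tuple nat -> nat) :
  recursive f -> recursive (fun v => code_size (f v)).
Proof.
move=> rf; apply: (recursive_sum (f := fun k v =>
  if iter k parent_code (f v) == 0 then 0 else 1)%N) => //.
apply: recursive_if (recursive_zero _) (recursive_const _ _).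
exact: recursive_iter_parent (recursive_thead _) (recursive_behead rf).
Qed.

Definition parity_prod (w : bool -> bool -> nat) (s : situation) : nat :=
  (\prod_(k < size s) w (odd k) (nth false s k))%N.

Lemma parity_prod_rcons w s x :
  parity_prod w (rcons s x) = (parity_prod w s * w (odd (size s)) x)%N.
Proof.
rewrite /parity_prod size_rcons big_ord_recr /= nth_rcons ltnn eqxx.
by congr muln; apply: eq_bigr => i _; rewrite nth_rcons ltn_ord.
Qed.

Lemma parity_prod_gt0 w s :
  (forall b x, (0 < w b x)%N) -> (0 < parity_prod w s)%N.
Proof. by move=> w_gt0; apply: prodn_gt0. Qed.

(* m is the code of a situation with last outcome x and l the length of its
   parent; m is odd exactly when x = 0, and the empty situation has code 0. *)
Definition code_weight (w : bool -> bool -> nat) (l m : nat) : nat :=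
  if m == 0%N then 1%N else w (odd l) (~~ odd m).

(** The factors are read from the last outcome back to the first: the [k]-th iterate of
    [parent_code] is [s] without its last [k] outcomes. Iterates beyond the root contribute 1. *)
Lemma parity_prodE w s : parity_prod w s =
  (let m := situation_code s in
  \prod_(k < m) code_weight w (code_size (iter k.+1 parent_code m))
    (iter k parent_code m))%N.
Proof.
rewrite /=; suff H K : (size s <= K)%N -> parity_prod w s =
    (\prod_(k < K) code_weight w
      (code_size (iter k.+1 parent_code (situation_code s)))
      (iter k parent_code (situation_code s)))%N.
  exact/H/size_situation_code.
elim/last_ind: s K => [|s x IHs] [|K].
- by rewrite /parity_prod !big_ord0.
- move=> _; rewrite /parity_prod big_ord0 big1 // => i _.
  by rewrite [X in code_weight _ _ X]iter_parent_code0.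
- by rewrite size_rcons.
rewrite size_rcons ltnS => sK; rewrite big_ord_recl.
under eq_bigr do rewrite !(iterSr _ _ (situation_code (rcons s x)))
  parent_code_rcons.
rewrite -IHs // parity_prod_rcons mulnC; congr muln.
rewrite /= parent_code_rcons code_sizeE /code_weight.
by rewrite odd_situation_code_rcons negbK situation_code_rcons.
Qed.

Lemma recursive_code_weight n w (l m : n.-tuple nat -> nat) :
  recursive l -> recursive m ->
  recursive (fun v => code_weight w (l v) (m v)).
Proof.
move=> /recursive_odd rl rm; have ro := recursive_odd rm.
have := recursive_if rm (recursive_const _ 1) (recursive_if rl
  (recursive_if ro (recursive_const _ (w false true))
    (recursive_const _ (w false false)))
  (recursive_if ro (recursive_const _ (w true true))
    (recursive_const _ (w true false)))).
apply: eq_recursive => v; rewrite /code_weight.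
by case: (m v == 0%N); case: (odd (l v)); case: (odd (m v)).
Qed.

Lemma computable_parity_prod w : computable_map (fun s _ => parity_prod w s).
Proof.
pose f k (v : 2.-tuple nat) := code_weight w
  (code_size (iter k.+1 parent_code (thead v))) (iter k parent_code (thead v)).
exists (fun v => \prod_(k < thead v) f k v)%N; last first.
  by move=> s n; rewrite parity_prodE /f !theadE.
apply: recursive_prod; first exact: recursive_thead.
have rt := recursive_behead (recursive_thead 1).
apply: recursive_code_weight.
  apply: recursive_code_size.
  exact: recursive_iter_parent (recursiveS (recursive_thead _)) rt.
exact: recursive_iter_parent (recursive_thead _) rt.
Qed.

Lemma computable_const k : computable_map (fun _ _ => k).
Proof. by exists (fun=> k) => //; exact: recursive_const. Qed.

(** * Betting on the situations of one length parity *)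

Section Betting.
Context {R : realType}.

(** The process is an exact computable fraction, so constant approximations with modulus 0
    suffice. *)
Lemma computable_parity_ratio u d : (forall b x, (0 < d b x)%N) ->
  computable_process
    (fun s => (parity_prod u s)%:R / (parity_prod d s)%:R : R).
Proof.
move=> d_gt0; exists (fun s _ => parity_prod u s), (fun s _ => parity_prod d s),
  (fun _ _ => 0%N), (fun _ _ => 0%N); split.
- split; [exact: computable_parity_prod|exact: computable_parity_prod| |];
  exact: computable_const.
- by move=> s _; apply: parity_prod_gt0.
- by move=> s n N _; rewrite expr0 mul1r subrr normr0 invr_ge0 exprn_ge0.
Qed.

Lemma forecast_ge0_le1 (I : interval_forecast R) t : forecast_set I t -> 0 <= t <= 1.
Proof.
have [a [b [a0 _ b1 ->]]] := forecast_setP I.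
by rewrite /= in_itv /= => /andP[at_ tb]; rewrite (le_trans a0) ?(le_trans tb).
Qed.

Lemma upper_expectation_le0 (I : interval_forecast R) f :
  upper_expectation I f <= 0 <->
  forall t, forecast_set I t -> t * f true + (1 - t) * f false <= 0.
Proof.
split=> [I0 t It|I0].
  apply: le_trans I0; apply: ub_le_sup; last by exists t.
  (* An explicit bound is required because [sup] is an upper bound only for sets bounded above. *)
  exists (`|f true| + `|f false|) => _ [r /forecast_ge0_le1/andP[r0 r1] <-].
  apply: lerD.
    by apply: (le_trans (ler_norm _)); rewrite normrM ger0_norm // ler_piMl.
  apply: (le_trans (ler_norm _)); rewrite normrM ger0_norm ?subr_ge0 //.
  by rewrite ler_piMl // gerBl.
apply: ge_sup => [|_ [t It <-]]; last exact: I0.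
have [a [b [_ ab _ IE]]] := forecast_setP I.
by exists (a * f true + (1 - a) * f false), a => //; rewrite IE /= in_itv /= lexx.
Qed.

Lemma computably_random_bounded gamma omega (T : real_process R) :
  computably_random gamma omega -> computable_process T ->
  test_supermartingale gamma T ->
  exists B, forall n, (0 < n)%N -> T (initial_segment omega n) <= B.
Proof.
move=> rnd cT tT; have := rnd _ cT tT.
set S := ereal_sup _ => S_lty.
have TS n : (0 < n)%N -> ((T (initial_segment omega n))%:E <= S)%E.
  by move=> n0; apply: ereal_sup_ubound; exists n.
clearbody S; case: S S_lty TS => [B _ TS| //|_ TS].
  by exists B => n /TS; rewrite lee_fin.
by exists 0 => n /TS.
Qed.

(** The capital of a gambler who multiplies it by [u x / D] on situations of length parity [b] and
    abstains on the others. *)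
Definition parity_bet (b : bool) (u : bool -> nat) (D : nat) (s : situation) : R :=
  (parity_prod (fun b' x => if b' == b then u x else 1%N) s)%:R /
  (parity_prod (fun b' _ => if b' == b then D else 1%N) s)%:R.

Lemma parity_bet_rcons b u D s x : parity_bet b u D (rcons s x) =
  parity_bet b u D s * (if odd (size s) == b then (u x)%:R / D%:R else 1).
Proof.
rewrite /parity_bet !parity_prod_rcons !natrM invfM mulrACA.
by case: ifP; rewrite // invr1 mulr1.
Qed.

Lemma parity_bet_ge0 b u D s : 0 <= parity_bet b u D s.
Proof. exact: divr_ge0. Qed.

Lemma computable_parity_bet b u D :
  (0 < D)%N -> computable_process (parity_bet b u D).
Proof. by move=> D0; apply: computable_parity_ratio => b' _; case: ifP. Qed.

(** The expected gain is the current capital times the expected factor minus 1, and the hypothesis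
    makes the expected factor at most 1. *)
Lemma test_supermartingale_parity_bet b u D gamma : (0 < D)%N ->
  (forall s, odd (size s) = b -> forall t, forecast_set (gamma s) t ->
    t * (u true)%:R + (1 - t) * (u false)%:R <= D%:R :> R) ->
  test_supermartingale gamma (parity_bet b u D).
Proof.
move=> D0 uD; split=> [s||]; last 2 first.
- exact: parity_bet_ge0.
- by rewrite /parity_bet /parity_prod !big_ord0 divr1.
apply/upper_expectation_le0 => t It.
rewrite /process_difference !parity_bet_rcons.
case: eqP => [sb|_]; last by rewrite !mulr1; lra.
set P := parity_bet _ _ _ _.
have -> : t * (P * ((u true)%:R / D%:R) - P) +
    (1 - t) * (P * ((u false)%:R / D%:R) - P) =
  P * ((t * (u true)%:R + (1 - t) * (u false)%:R) / D%:R - 1) by ring.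
rewrite mulr_ge0_le0 ?parity_bet_ge0 // subr_le0 ler_pdivrMr ?ltr0n // mul1r.
exact: uD sb _ It.
Qed.

(** For integers the hypothesis gives [u x * v x >= D ^ 2 + 1], so each active step multiplies the
    product by at least [1 + d] with [d = 1 / D ^ 2], whatever the outcome. *)
Lemma parity_bets_unbounded b u v D omega : (0 < D)%N ->
  (forall x, (D ^ 2 < u x * v x)%N) ->
  forall B, exists n, (0 < n)%N /\
    B < parity_bet b u D (initial_segment omega n) *
        parity_bet b v D (initial_segment omega n).
Proof.
move=> D0 uvD B; pose Q s := parity_bet b u D s * parity_bet b v D s.
pose d : R := (D ^ 2)%:R^-1.
have d0 : 0 < d by rewrite invr_gt0 ltr0n expn_gt0 D0.
have Q0 s : 0 <= Q s by rewrite mulr_ge0 ?parity_bet_ge0.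
have QS n : Q (initial_segment omega n) * (if odd n == b then 1 + d else 1) <=
    Q (initial_segment omega n.+1).
  rewrite /initial_segment mkseqS {2}/Q !parity_bet_rcons mulrACA size_mkseq.
  apply: ler_wpM2l; first exact: Q0.
  case: ifP => _; last by rewrite mulr1.
  rewrite mulrACA -invfM -!natrM mulnn.
  rewrite ler_pdivlMr ?ltr0n ?expn_gt0 ?D0 //.
  rewrite mulrDl mul1r mulVf ?pnatr_eq0 -?lt0n ?expn_gt0 ?D0 //.
  by rewrite natr1 ler_nat.
(* Two consecutive steps contain exactly one active step; Bernoulli's inequality then gives linear
   growth. *)
have QSS m : 1 + d *+ m <= Q (initial_segment omega m.*2).
  elim: m => [|m IHm].
    by rewrite mulr0n addr0 /Q /parity_bet /parity_prod /= !big_ord0 !divr1 mulr1.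
  rewrite doubleS; apply: le_trans (QS _); rewrite /= odd_double /=.
  have := QS m.*2; rewrite odd_double.
  have dm0 : 0 <= d * (d *+ m) by rewrite mulr_ge0 ?mulrn_wge0 // ltW.
  by rewrite mulrSr; case: (b) => /=; rewrite ?mulr1; nra.
exists (Num.truncn (B / d)).+1.*2; split; first by rewrite double_gt0.
apply: lt_le_trans (QSS _); apply: (@lt_le_trans _ _ (d *+ (Num.truncn (B / d)).+1)).
  by rewrite -mulr_natr -ltr_pdivrMl // mulrC truncnS_gt.
by rewrite lerDr.
Qed.

Lemma not_computably_random_both (gamma1 gamma2 : forecasting_system R)
    (b : bool) (c d : R) omega : 0 <= c -> c < d -> d <= 1 ->
  (forall s, odd (size s) = b -> forall t, forecast_set (gamma1 s) t -> t <= c) ->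
  (forall s, odd (size s) = b -> forall t, forecast_set (gamma2 s) t -> d <= t) ->
  computably_random gamma1 omega -> computably_random gamma2 omega -> False.
Proof.
move=> c0 cd d1 g1 g2 rnd1 rnd2.
(* The choice c1 = i / N, c2 = (i + 1) / N and e = 1 / (2 N) makes the betting
   factors multiples of 1 / D for D = 2 N ^ 2. *)
pose N := (Num.truncn (2 / (d - c))).+1; pose i := (Num.truncn (c * N%:R)).+1.
have dc0 : 0 < d - c by rewrite subr_gt0.
have N2 : 2 < (d - c) * N%:R.
  by rewrite mulrC -ltr_pdivrMr // truncnS_gt.
have ci : c * N%:R < i%:R by rewrite truncnS_gt.
have ic : i%:R <= c * N%:R + 1.
  by rewrite -natr1 lerD2r truncn_le ?mulr_ge0.
have iN : (i.+1 < N)%N by rewrite -(ltr_nat R) -natr1; nra.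
have Ngt1 : (1 < N)%N by lia.
clearbody i N.
pose D := (2 * N ^ 2)%N.
(* Here [u x / D = 1 + e (x - c1)] and [v x / D = 1 - e (x - c2)]; no subtraction is truncated,
   since [i < N <= D]. *)
pose u (x : bool) := (D + x * N - i)%N.
pose v (x : bool) := (D + i.+1 - x * N)%N.
have D0 : (0 < D)%N by rewrite /D; lia.
have ND : (N <= D)%N by rewrite /D; nia.
have uE x : (u x)%:R = D%:R + x%:R * N%:R - i%:R :> R.
  by rewrite natrB ?natrD ?natrM //; lia.
have vE x : (v x)%:R = D%:R + i%:R + 1 - x%:R * N%:R :> R.
  rewrite natrB ?natrD ?natrM -?[i.+1%:R]natr1 ?addrA //.
  by case: x; lia.
have [|B1 hB1] := computably_random_bounded (T := parity_bet b u D) rnd1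
    (computable_parity_bet _ _ D0).
  (* The expectation of [u] is [D + t N - i], and [t N <= c N < i]. *)
  apply: test_supermartingale_parity_bet => // s sb t /(g1 _ sb) tc.
  rewrite !uE /=; nra.
have [|B2 hB2] := computably_random_bounded (T := parity_bet b v D) rnd2
    (computable_parity_bet _ _ D0).
  (* The expectation of [v] is [D + i + 1 - t N], and [i + 1 <= c N + 2 < d N <= t N]. *)
  apply: test_supermartingale_parity_bet => // s sb t /(g2 _ sb) td.
  rewrite !vE /=; nra.
(* With [y = x N - i] the product is [D ^ 2 + D + y (1 - y)]; as [|y| <= N] and [N > 1], the choice
   [D = 2 N ^ 2] keeps the excess positive. *)
have uvD x : (D ^ 2 < u x * v x)%N.
  by rewrite /u /v /D; case: x; nia.
have [n [n0]] := parity_bets_unbounded b omega D0 uvD (B1 * B2).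
by apply/negP; rewrite -leNgt ler_pM ?parity_bet_ge0 ?hB1 ?hB2.
Qed.

End Betting.

Theorem proposition14 (R : realType) (p q : R)
    (hp : 0 <= p <= 1) (hq : 0 <= q <= 1) (hpq : p <= q)
    (omega : outcome_sequence) :
  computably_random (alternating_forecast hp hq) omega ->
  forall I : interval_forecast R, CC omega I <-> `[p, q]%classic `<=` I.
Proof.
move=> rnd I; have [a [b [a0 ab b1 IE]]] := forecast_setP I.
split=> [rndI|pqI]; last first.
  move=> T cT [sT T0 T1]; apply: rnd => //; split => // s.
  have /upper_expectation_le0 sI := sT s.
  apply/upper_expectation_le0 => t; rewrite /alternating_forecast.
  by case: ifP => _ /= ->; apply: sI; apply: pqI; rewrite /= in_itv /= lexx hpq.
(* [c] is the length parity on which the alternating forecast is [r]. It suffices to place both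
   endpoints in [I], which is an interval. *)
have inI (c : bool) r : r = (if c then p else q) -> a <= r <= b.
  move=> rE.
  have r01 : 0 <= r <= 1 by rewrite rE; case: c {rE}.
  have gr s : odd (size s) = c ->
      forall t, forecast_set (alternating_forecast hp hq s) t -> t = r.
    by rewrite rE /alternating_forecast => -> t; case: c {rE}.
  have Ir s t : forecast_set (stationary I s) t -> a <= t <= b.
    by rewrite /stationary IE /= in_itv.
  case/andP: r01 => r0 r1.
  (* If [r < a] the alternating system has the lower forecasts; if [b < r] the stationary one has,
     and the two systems swap places. *)
  apply/andP; split; rewrite leNgt; apply/negP => lt_r.
    apply: (@not_computably_random_both R _ _ c r a omega _ _ _ _ _ rnd rndI) => //.
    - exact: le_trans ab b1.
    - by move=> s /gr gs t /gs ->.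
    - by move=> s _ t /Ir /andP[].
  apply: (@not_computably_random_both R _ _ c b r omega _ _ _ _ _ rndI rnd) => //.
  - exact: le_trans a0 ab.
  - by move=> s _ t /Ir /andP[].
  - by move=> s /gr gs t /gs ->.
have /andP[ap _] := inI true p erefl.
have /andP[_ qb] := inI false q erefl.
move=> t; rewrite IE /= !in_itv /= => /andP[pt tq].
by rewrite (le_trans ap pt) (le_trans tq qb).
Qed.
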